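(* Let $n\ge1$ and let $p_1,\dots,p_n\in(0,1]$. If $p_i=1$ for some $i\in\{1,\dots,n\}$, then the standard game, Variant I and Variant II are equivalent, i.e. $\mathcal{V}(p_1,\dots,p_n)=\mathcal{V}^{**}(p_1,\dots,p_n)=\mathcal{V}^*(p_1,\dots,p_n)$. Otherwise, $$\mathcal{V}(p_1,\dots,p_n)\le\mathcal{V}^{**}(p_1,\dots,p_n)<\mathcal{V}^*(p_1,\dots,p_n).$$
   Context: Last-success (standard) game: independent Bernoulli variables $I_1,\dots,I_n$ with $P(I_i=1)=p_i>0$ are observed sequentially, and the player wins if he stops on the last variable equal to $1$. Put $q_i=1-p_i$, $r_i=p_i/q_i$ (with $r_i=\infty$ if $p_i=1$), $R_k=\sum_{i=k}^n r_i\in[0,\infty]$, $Q_k=\prod_{i=k}^n q_i$ (empty sum $=0$, empty product $=1$). The optimal threshold is $\mathbf{s}=\max\{1\le k\le n: R_k\ge 1\}$ if $R_1\ge 1$, and $\mathbf{s}=1$ otherwise. The optimal win probability of the standard game is $\mathcal{V}(p_1,\dots,p_n)=Q_{\mathbf{s}}R_{\mathbf{s}}$ if $p_{\mathbf{s}}<1$ and $\mathcal{V}(p_1,\dots,p_n)=Q_{\mathbf{s}+1}$ if $p_{\mathbf{s}}=1$. Variant I: if all the variables turn out to be $0$ this is not a failure, and the game is repeated as many times as necessary until a $1$ appears; the probability of winning with the optimal strategy is $\mathcal{V}^*(p_1,\dots,p_n)=\mathcal{V}(p_1,\dots,p_n)/(1-Q_1)$. Variant II: before observing any variable the player chooses either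 to play the standard game or to predict that all the variables will equal $0$ (winning in the latter case with probability $Q_1$); the probability of winning with the optimal strategy is $\mathcal{V}^{**}(p_1,\dots,p_n)=\max\{Q_1,\mathcal{V}(p_1,\dots,p_n)\}$. *)

(* Defs.v *)
From mathcomp Require Import all_boot all_order all_algebra.
From mathcomp Require Import constructive_ereal reals.

Set Implicit Arguments.
Unset Strict Implicit.
Unset Printing Implicit Defensive.

Import Order.TTheory GRing.Theory Num.Theory.

Local Open Scope ring_scope.

(* The success probabilities p_1, ..., p_n are the values at 1, ..., n of a
   function p : nat -> R; the values of p outside 1 .. n are never used. *)

Definition odds (R : realType) (p : nat -> R) (i : nat) : \bar R :=
  if p i == 1 then +oo%E else (p i / (1 - p i))%:E.

Definition sum_odds (R : realType) (n : nat) (p : nat -> R) (k : nat) : \bar R :=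
  (\sum_(k <= i < n.+1) odds p i)%E.

Definition prob_no_success (R : realType) (n : nat) (p : nat -> R) (k : nat) : R :=
  \prod_(k <= i < n.+1) (1 - p i).

Definition threshold (R : realType) (n : nat) (p : nat -> R) : nat :=
  if (1 <= sum_odds n p 1)%E
  then \max_(1 <= k < n.+1 | (1 <= sum_odds n p k)%E) k
  else 1%N.

(* Optimal probability of stopping on the last 1 (Bruss's odds theorem): stop on
   the first 1 from time s on, and win if exactly one 1 occurs from s on; if
   p_s = 1, the stop is at s and the win requires zeros afterwards.
   When p_s < 1 at the threshold s, every p_i with s <= i <= n is < 1, since
   p_i = 1 would give an infinite sum of odds from i on and hence i <= s.  So
   the sum of odds from s on is finite and fine loses nothing. *)
Definition win_standard (R : realType) (n : nat) (p : nat -> R) : R :=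
  let s := threshold n p in
  if p s < 1 then prob_no_success n p s * fine (sum_odds n p s)
  else prob_no_success n p s.+1.

(* All-zero rounds are replayed until a 1 appears, so the value is a geometric
   series: win_standard * (1 + Q_1 + Q_1 ^+ 2 + ...), Q_1 the probability of an
   all-zero round. *)
Definition win_variant1 (R : realType) (n : nat) (p : nat -> R) : R :=
  win_standard n p / (1 - prob_no_success n p 1).

(* Before the first observation the player may instead bet on all zeros. *)
Definition win_variant2 (R : realType) (n : nat) (p : nat -> R) : R :=
  Num.max (prob_no_success n p 1) (win_standard n p).

(* Main.v *)
Require Import Defs.
From mathcomp Require Import all_boot all_order all_algebra.
From mathcomp Require Import constructive_ereal reals.

(** If some [p i = 1] then [Q_1 = 0] and all three values agree. Otherwise
    [0 < Q_1 < 1] and [V > 0], so the point is [Q_1 (1 - Q_1) < V]. If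
    [R_1 >= 1] then [R_s >= 1] and [V = Q_s R_s >= Q_s >= Q_1]. If [R_1 < 1]
    then [s = 1] and, by the union bound,
    [1 - Q_1 <= \sum p_i < \sum p_i / (1 - p_i) = R_1]. *)

Import Order.TTheory GRing.Theory Num.Theory.

Local Open Scope ring_scope.

(** The two bounds are proved together because the induction needs both: if the remaining product
    [P'] is at most 1, then [(1 - x) P' = P' - x P' >= P' - x]. *)
Lemma union_bound (R : realDomainType) (I : Type) (r : seq I) (P : pred I)
    (x : I -> R) :
  (forall i, P i -> 0 <= x i <= 1) ->
  1 - \sum_(i <- r | P i) x i <= \prod_(i <- r | P i) (1 - x i) <= 1.
Proof.
move=> hx; elim: r => [|i r /andP[IHl IHr]].
  by rewrite !big_nil subr0 lexx.
rewrite !big_cons; case: ifP => [Pi|_]; last by rewrite IHl IHr.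
have /andP[x0 x1] := hx i Pi.
rewrite [(1 - x i) * _]mulrBl mul1r; apply/andP; split.
  rewrite [x i + _]addrC opprD addrA lerB //.
  by rewrite -[leRHS]mulr1 ler_wpM2l.
rewrite lerBlDr (le_trans IHr) // lerDl mulr_ge0 //.
by apply: prodr_ge0 => j /hx /andP[_]; rewrite subr_ge0.
Qed.

Section LastSuccess.
Variables (R : realType) (n : nat) (p : nat -> R).
Hypotheses (n_gt0 : (1 <= n)%N)
  (p01 : forall i : nat, (1 <= i <= n)%N -> 0 < p i <= 1).

Lemma in_range k i : (1 <= k)%N -> (k <= i < n.+1)%N -> (1 <= i <= n)%N.
Proof. by move=> k1 /andP[ki]; rewrite ltnS (leq_trans k1 ki) => ->. Qed.

Lemma prob_no_success_ge0 k : (1 <= k)%N -> 0 <= prob_no_success n p k.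
Proof.
move=> k1; rewrite /prob_no_success big_nat_cond.
by apply: prodr_ge0 => i /andP[/(in_range _ _ k1)/p01/andP[_]]; rewrite subr_ge0.
Qed.

Lemma sum_odds_ge0 k : (1 <= k)%N -> (0 <= sum_odds n p k)%E.
Proof.
move=> k1; rewrite /sum_odds big_nat_cond.
apply: sume_ge0 => i /andP[/(in_range _ _ k1)/p01/andP[pi0 pi1] _].
rewrite /odds; case: ifP => _; first exact: leey.
by rewrite lee_fin divr_ge0 ?subr_ge0 // ltW.
Qed.

Lemma threshold_range : (1 <= threshold n p <= n)%N.
Proof.
rewrite /threshold; case: ifP => [R1|_]; last by rewrite n_gt0.
apply/andP; split.
  by apply: (leq_bigmax_seq (F := id) 1%N); rewrite ?mem_index_iota.
by apply/bigmax_leqP_seq => i; rewrite mem_index_iota ltnS => /andP[].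
Qed.

Lemma sum_odds_threshold :
  (1 <= sum_odds n p 1)%E -> (1 <= sum_odds n p (threshold n p))%E.
Proof.
move=> R1; have /andP[] := threshold_range; rewrite /threshold R1 => s1 _.
(* The disjunct [s == 0] covers the value of an empty maximum, so that the property passes through
   [big_ind]; [s1] then excludes it. *)
have : let s := \max_(1 <= k < n.+1 | (1 <= sum_odds n p k)%E) k in
    (s == 0)%N || (1 <= sum_odds n p s)%E.
  elim/big_ind: _ => //= [x y hx hy|i ->]; last by rewrite orbT.
  by rewrite /maxn; case: ifP.
by move=> /= /orP[/eqP s0|//]; rewrite s0 in s1.
Qed.

Lemma win_standard_ge0 : 0 <= win_standard n p.
Proof.
have /andP[s1 _] := threshold_range.
rewrite /win_standard; case: ifP => _; last exact: prob_no_success_ge0.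
by rewrite mulr_ge0 ?prob_no_success_ge0 ?fine_ge0 ?sum_odds_ge0.
Qed.

Section NoSureSuccess.
Hypothesis p_lt1 : forall i : nat, (1 <= i <= n)%N -> p i < 1.

Lemma prob_no_success_gt0 k : (1 <= k)%N -> 0 < prob_no_success n p k.
Proof.
move=> k1; rewrite /prob_no_success big_nat_cond.
by apply: prodr_gt0 => i /andP[/(in_range _ _ k1)/p_lt1]; rewrite subr_gt0.
Qed.

(** Strictness comes from the first factor [1 - p 1], present since [n >= 1]; the upper half of
    [union_bound] handles the others. *)
Lemma prob_no_success_lt1 : prob_no_success n p 1 < 1.
Proof.
rewrite /prob_no_success big_ltn // big_nat_cond.
have /andP[p1 _] := p01 1%N n_gt0.
have /andP[_ Q2] : 1 - \sum_(2 <= i < n.+1 | (2 <= i < n.+1)%N && true) p i <=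
    \prod_(2 <= i < n.+1 | (2 <= i < n.+1)%N && true) (1 - p i) <= 1.
  apply: union_bound => i /andP[/in_range-/(_ isT)/p01/andP[pi0 pi1] _].
  by rewrite ltW.
have p1' : 0 <= 1 - p 1%N by rewrite subr_ge0 ltW // p_lt1.
apply: (le_lt_trans (ler_wpM2l p1' Q2)).
by rewrite mulr1 ltrBlDr ltrDl.
Qed.

Lemma le_prob_no_success k :
  (1 <= k <= n)%N -> prob_no_success n p 1 <= prob_no_success n p k.
Proof.
move=> /andP[k1 kn]; rewrite /prob_no_success (big_cat_nat k1) /=; last exact: leqW.
rewrite ger_pMl ?prob_no_success_gt0 // big_nat_cond.
apply: prodr_ile1 => i /andP[/andP[i1 ik] _].
have /p01/andP[pi0 pi1] : (1 <= i <= n)%N.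
  by rewrite i1 (leq_trans (ltnW ik)).
by rewrite subr_ge0 pi1 lerBlDr lerDl ltW.
Qed.

(** Without a sure success all odds are finite, so [fine] in [win_standard] returns the true sum. *)
Lemma sum_oddsE k : (1 <= k)%N ->
  sum_odds n p k = (\sum_(k <= i < n.+1) p i / (1 - p i))%:E.
Proof.
move=> k1; rewrite /sum_odds -sumEFin; apply: eq_big_nat => i hi.
by rewrite /odds lt_eqF // p_lt1 // (in_range _ _ k1 hi).
Qed.

Lemma prob_some_success_lt_sum_odds :
  1 - prob_no_success n p 1 < \sum_(1 <= i < n.+1) p i / (1 - p i).
Proof.
apply: (@le_lt_trans _ _ (\sum_(1 <= i < n.+1) p i)).
  rewrite lerBlDr addrC -lerBlDr /prob_no_success.
  rewrite [in leLHS]big_nat_cond [leRHS]big_nat_cond.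
  have /union_bound-/(_ (index_iota 1 n.+1))/andP[] // : forall i,
      (1 <= i < n.+1)%N && true -> 0 <= p i <= 1.
  by move=> i /andP[/in_range-/(_ isT)/p01/andP[pi0 pi1] _]; rewrite ltW.
(* Termwise, dividing [p i > 0] by [1 - p i], which lies strictly between 0 and 1, increases it; the
   sum is nonempty, so strictness survives. *)
apply: ltr_sum_nat => // i /in_range-/(_ isT) hi.
have /andP[pi0 _] := p01 i hi.
by rewrite ltr_pdivlMr ?subr_gt0 ?p_lt1 // gtr_pMr // ltrBlDr ltrDl.
Qed.

Lemma prob_no_success_mul_lt_win_standard :
  prob_no_success n p 1 * (1 - prob_no_success n p 1) < win_standard n p.
Proof.
have /andP[s1 sn] := threshold_range.
have Q0 := prob_no_success_gt0 1%N isT.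
rewrite /win_standard p_lt1 ?s1 //.
have [R1|R1] := boolP (1 <= sum_odds n p 1)%E; last first.
  (* The threshold takes its default value 1, so both sides share the factor [Q_1 > 0], which
     cancels. *)
  rewrite /threshold (negbTE R1) sum_oddsE //= ltr_pM2l //.
  exact: prob_some_success_lt_sum_odds.
have := sum_odds_threshold R1; rewrite sum_oddsE //= lee_fin => Rs.
(* Here the strict inequality is [Q_1 (1 - Q_1) < Q_1]; the rest of the chain
   [Q_1 <= Q_s <= Q_s R_s] is weak. *)
apply: (@lt_le_trans _ _ (prob_no_success n p 1)).
  by rewrite gtr_pMr // ltrBlDr ltrDl.
apply: (@le_trans _ _ (prob_no_success n p (threshold n p))).
  by rewrite le_prob_no_success ?s1.
by rewrite ler_peMr // prob_no_success_ge0.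
Qed.

End NoSureSuccess.

Lemma prob_no_success_eq0 i :
  (1 <= i <= n)%N -> p i = 1 -> prob_no_success n p 1 = 0.
Proof.
move=> hi pi1; apply/eqP; rewrite /prob_no_success prodf_seq_eq0.
by apply/hasP; exists i; rewrite ?mem_index_iota //= pi1 subrr.
Qed.

End LastSuccess.

Theorem theorem14 (R : realType) (n : nat) (p : nat -> R)
    (hn : (1 <= n)%N)
    (hp : forall i : nat, (1 <= i <= n)%N -> 0 < p i <= 1) :
  ((exists2 i : nat, (1 <= i <= n)%N & p i = 1) ->
     win_standard n p = win_variant2 n p /\
     win_variant2 n p = win_variant1 n p) /\
  (~ (exists2 i : nat, (1 <= i <= n)%N & p i = 1) ->
     win_standard n p <= win_variant2 n p /\
     win_variant2 n p < win_variant1 n p).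
Proof.
rewrite /win_variant1 /win_variant2; split.
  move=> [i hi pi1]; rewrite (prob_no_success_eq0 _ _ _ i) //.
  by rewrite subr0 divr1 max_r // win_standard_ge0.
move=> noone; have p_lt1 i : (1 <= i <= n)%N -> p i < 1.
  move=> hi; have /andP[_ pi1] := hp i hi.
  by rewrite lt_neqAle pi1 andbT; apply/eqP => pE; apply: noone; exists i.
have Q0 := prob_no_success_gt0 _ _ _ p_lt1 1%N isT.
have Q1 := prob_no_success_lt1 _ _ _ hn hp p_lt1.
have QV := prob_no_success_mul_lt_win_standard _ _ _ hn hp p_lt1.
have Qc0 : 0 < 1 - prob_no_success n p 1 by rewrite subr_gt0.
have V0 : 0 < win_standard n p by apply: lt_trans QV; rewrite mulr_gt0.
split; first by rewrite le_max lexx orbT.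
(* Clearing the denominator splits the claim into [Q_1 (1 - Q_1) < V], which is [QV], and
   [V (1 - Q_1) < V], which follows from [V > 0] and [Q_1 > 0]. *)
rewrite gt_max !ltr_pdivlMr // QV /=.
by rewrite gtr_pMr // ltrBlDr ltrDl.
Qed.
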